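(* Consider the Basic Independence Model and let $0<\lambda\le\lambda_1<\gamma_1\le1$ and $0<\alpha<\lambda$. Let $$\hat n_0(\lambda_1,\gamma_1)=n\,\frac{\hat F_n(\gamma_1)-\hat F_n(\lambda_1)+\frac1n}{\gamma_1-\lambda_1}$$ be the generalized Storey estimator. Then $$E\left(\frac{V(\lambda)}{\hat n_0(\lambda_1,\gamma_1)}\,\Big|\,(\hat F_n(t))_{t\ge\gamma_1}\right)\le\lambda$$ and $$E\left(\frac{V(\lambda)}{\hat n_0(\lambda_1,\gamma_1)}\right)\le\lambda$$ hold, and the adaptive step up test with critical values $\hat\alpha_{i:n}=\left(\frac{i}{\hat n_0(\lambda_1,\gamma_1)}\alpha\right)\wedge\lambda$, $i=1,\dots,n$, has $FDR\le\alpha$.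
   Context: Basic Independence (BI) Model: $n\ge 1$ null hypotheses $\mathcal H_1,\dots,\mathcal H_n$; $(H_i,\xi_i)_{i\le n}$ is an arbitrary random vector with values in $(\{0,1\}\times[0,1])^n$; $U_1,\dots,U_n$ are independent, uniformly distributed on $(0,1)$, and independent of $(H_i,\xi_i)_{i\le n}$. $\mathcal H_i$ is true if $H_i=0$ and false if $H_i=1$. The $p$-values are $p_i=(1-H_i)U_i+H_i\xi_i$. Put $N_0=\sum_{i=1}^n(1-H_i)$ and assume $E(N_0)>0$. Let $\hat F_n(t)=\frac1n\sum_{i=1}^n 1\{p_i\le t\}$, $t\in[0,1]$, and let $p_{1:n}\le\dots\le p_{n:n}$ be the order statistics of the $p$-values. Notation: $a\wedge b=\min(a,b)$, $a\vee b=\max(a,b)$. For $t\in[0,1]$: $V(t)=\sum_{i=1}^n 1\{p_i\le t,H_i=0\}$. Adaptive step up (SU) test with data dependent critical values $0=\hat\alpha_{0:n}<\hat\alpha_{1:n}\le\dots\le\hat\alpha_{n:n}<1$: with $R=\max\{i: p_{i:n}\le\hat\alpha_{i:n}\}$ ($\max\emptyset=0$), it rejects all null hypotheses whose $p$-value is $\le\hat\alpha_{R:n}$; $R$ is the number of rejections. With $V=\sum_{i=1}^n 1\{p_i\le\hat\alpha_{R:n},H_i=0\}$, $FDR=E\left(\frac{V}{R\vee 1}\right)$. Inequalities between conditional expectations and constants are understood almost surely. *)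

(* Defs.v *)
From HB Require Import structures.
From mathcomp Require Import all_boot all_order all_algebra.
From mathcomp Require Import all_classical all_reals all_analysis.
From mathcomp Require Import measurable_realfun.
Set Implicit Arguments.
Unset Strict Implicit.
Unset Printing Implicit Defensive.
Import Order.TTheory GRing.Theory Num.Theory.
Import numFieldNormedType.Exports.
Local Open Scope classical_set_scope.
Local Open Scope ring_scope.

Definition indep_systems d (T : measurableType d) (R : realType)
    (P : probability T R) (G1 G2 : set (set T)) : Prop :=
  forall A B, G1 A -> G2 B -> P (A `&` B) = (P A * P B)%E.

Definition mutually_independent d (T : measurableType d) (R : realType)
    (P : probability T R) n (X : 'I_n -> {RV P >-> R}) : Prop :=
  forall (J : {set 'I_n}) (B : 'I_n -> set R),
    (forall i, measurable (B i)) ->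
    P (\bigcap_(i in [set` J]) (X i @^-1` B i)) =
    (\prod_(i in J) P (X i @^-1` B i))%E.

(* [is_cond_exp P F X Y]: [Y] is a version of the conditional expectation of
   [X] given the sigma-algebra [<<s F >>]. *)
Definition is_cond_exp d (T : measurableType d) (R : realType)
    (P : probability T R) (F : set (set T)) (X Y : T -> R) : Prop :=
  [/\ measurable_fun [set: g_sigma_algebraType F]
        (Y : g_sigma_algebraType F -> R),
      P.-integrable [set: T] (EFin \o Y)
    & forall A, <<s F >> A ->
        (\int[P]_(w in A) (Y w)%:E = \int[P]_(w in A) (X w)%:E)%E].

(* Radon-Nikodym along a measurable map; [cond_exp_exists] below is the case
   of the identity from [T] to [T] with a coarser sigma-algebra. *)
Lemma cond_exp_factor d d' (T : measurableType d) (S : measurableType d')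
    (R : realType) (P : probability T R) (g : {mfun T >-> S}) (X : T -> R) :
  P.-integrable [set: T] (EFin \o X) ->
  exists Y : S -> R, [/\ measurable_fun [set: S] Y,
    P.-integrable [set: T] (EFin \o (Y \o g)) &
    forall A, measurable A ->
      (\int[P]_(w in g @^-1` A) (Y (g w))%:E =
       \int[P]_(w in g @^-1` A) (X w)%:E)%E].
Proof.
move=> intX.
have mg A : measurable A -> measurable (g @^-1` A).
  by move=> mA; rewrite -[X in measurable X]setTI; exact: measurable_funP.
pose Q : probability S R := distribution P g.
pose nu : {charge set T -> \bar R} := induced_charge intX.
pose nuS : set S -> \bar R := pushforward nu g.
have nuS0 : nuS set0 = 0%E by rewrite /nuS /pushforward preimage_set0 charge0.
have nuSfin A : measurable A -> nuS A \is a fin_num.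
  by move=> mA; apply: (fin_num_measure nu); exact: mg.
have nuSadd : semi_sigma_additive nuS.
  move=> G mG tG mUG; rewrite /nuS /pushforward preimage_bigcup.
  apply: charge_semi_sigma_additive.
  - by move=> i; exact: mg.
  - apply/trivIsetP => /= i j _ _ ij; rewrite -preimage_setI.
    by move/trivIsetP : tG => /(_ _ _ _ _ ij) ->//; rewrite preimage_set0.
  - by rewrite -preimage_bigcup; exact: mg.
pose nuC : {charge set S -> \bar R} := HB.pack nuS
  (isCharge.Build _ _ _ nuS nuS0 nuSfin nuSadd).
have nuQ : nuC `<< Q.
  apply/null_content_dominatesP => A mA QA0.
  apply: null_set_integral => //; first exact: mg.
  by apply: measurable_funTS; exact: measurable_int intX.
pose f := Radon_Nikodym nuC Q.
have ffin x : f x \is a fin_num by exact: Radon_Nikodym_fin_num.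
have intf : Q.-integrable [set: S] f by exact: Radon_Nikodym_integrable.
have mf : measurable_fun [set: S] f by exact: measurable_int intf.
have intfP : P.-integrable [set: T] (f \o g).
  apply/integrableP; split; first exact: measurableT_comp.
  case/integrableP : intf => _; apply: le_lt_trans.
  rewrite ge0_integral_pushforward//.
  exact: measurableT_comp.
have fK : EFin \o (fine \o f) = f by apply/funext => x /=; rewrite fineK.
exists (fine \o f); split.
- by apply/measurable_EFinP; rewrite fK.
- by rewrite (_ : EFin \o _ = f \o g)//; apply/funext => x /=; rewrite fineK.
- move=> A mA; rewrite -[RHS]/(nuC A) (Radon_Nikodym_integral nuQ mA).
  rewrite integral_pushforward//; last first.
    by apply: (integrableS measurableT) intfP => //; exact: mg.
  by apply: eq_integral => x _ /=; rewrite fineK.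
Qed.

Lemma cond_exp_exists d (T : measurableType d) (R : realType)
    (P : probability T R) (F : set (set T)) (X : T -> R) :
  F `<=` measurable -> P.-integrable [set: T] (EFin \o X) ->
  exists Y, is_cond_exp P F X Y.
Proof.
move=> sFm intX.
have mid : measurable_fun [set: T] (idfun : T -> g_sigma_algebraType F).
  move=> _ B; rewrite setTI; apply: smallest_sub => //; split.
  - exact: measurable0.
  - by move=> C mC; rewrite setTD; exact: measurableC.
  - by move=> G mG; exact: bigcupT_measurable.
pose iota : {mfun T >-> g_sigma_algebraType F} := HB.pack
  (idfun : T -> g_sigma_algebraType F) (isMeasurableFun.Build _ _ _ _ _ mid).
by have [Y [mY iY eY]] := cond_exp_factor iota intX; exists Y; split.
Qed.

(* [H i w = true] encodes [H_i = 1], i.e. the i-th null hypothesis is false. *)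

Definition pvalue n (T : Type) (R : realType) (H : 'I_n -> T -> bool)
    (xi U : 'I_n -> T -> R) (w : T) (i : 'I_n) : R :=
  (1 - (H i w)%:R) * U i w + (H i w)%:R * xi i w.

Definition basic_independence d (T : measurableType d) (R : realType)
    (P : probability T R) n (H : 'I_n -> {RV P >-> bool})
    (xi U : 'I_n -> {RV P >-> R}) : Prop :=
  [/\ forall i w, 0 <= xi i w <= 1,
      forall i (B : set R), measurable B ->
        distribution P (U i) B = uniform_prob (@ltr01 R) B,
      mutually_independent U,
      indep_systems P (g_sigma_preimage (fun i w => U i w))
        (g_sigma_preimage (fun i w => (H i w, xi i w)))
    & (0 < 'E_P[(fun w => \sum_(i < n) (1 - (H i w)%:R))%R])%E].

(* From here on, [p : 'I_n -> R] and [h : 'I_n -> bool] are realisations of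
   the p-values and of the [H i]. *)

Definition ecdf n (R : realType) (p : 'I_n -> R) (t : R) : R :=
  n%:R^-1 * \sum_(i < n) (p i <= t)%R%:R.

Definition num_true_below n (R : realType) (h : 'I_n -> bool)
    (p : 'I_n -> R) (t : R) : nat :=
  (\sum_(i < n) ((p i <= t)%R && ~~ h i))%N.

(* 1-based: [order_stat p i] is p_{i:n} only for 1 <= i <= n. *)
Definition order_stat n (R : realType) (p : 'I_n -> R) (i : nat) : R :=
  nth 0 (sort <=%R [seq p j | j <- enum 'I_n]) i.-1.

(* In the step up procedure, [c i] is the i-th critical value, 0 <= i <= n. *)
Definition su_rejections n (R : realType) (p : 'I_n -> R) (c : nat -> R)
    : nat :=
  \max_(i < n.+1 | (0 < i)%N && (order_stat p i <= c i)) i.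

Definition su_false_rejections n (R : realType) (h : 'I_n -> bool)
    (p : 'I_n -> R) (c : nat -> R) : nat :=
  num_true_below h p (c (su_rejections p c)).

Definition FDR d (T : measurableType d) (R : realType) (P : probability T R)
    n (H : 'I_n -> T -> bool) (p : T -> 'I_n -> R) (c : T -> nat -> R)
    : \bar R :=
  ('E_P[(fun w => (su_false_rejections (H ^~ w) (p w) (c w))%:R /
                  (maxn (su_rejections (p w) (c w)) 1)%:R)%R])%E.

Definition storey n (R : realType) (lambda1 gamma1 : R) (p : 'I_n -> R) : R :=
  n%:R * ((ecdf p gamma1 - ecdf p lambda1 + n%:R^-1) / (gamma1 - lambda1)).

(* At [i = 0] this is 0 when [0 <= lambda]: the convention for the 0-th
   critical value needs no separate case. *)
Definition adaptive_crit (R : realType) (n0 alpha lambda : R) (i : nat) : R :=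
  Num.min (i%:R / n0 * alpha) lambda.

(* Main.v *)
Require Import Defs.
From HB Require Import structures.
From mathcomp Require Import all_boot all_order all_algebra.
From mathcomp Require Import all_classical all_reals all_analysis.
From mathcomp Require Import measurable_realfun.
From mathcomp Require Import ring.
Set Implicit Arguments.
Unset Strict Implicit.
Unset Printing Implicit Defensive.
Import Order.TTheory GRing.Theory Num.Theory.
Import numFieldNormedType.Exports.
Local Open Scope classical_set_scope.
Local Open Scope ring_scope.

(** Let S be the number of p-values in (lambda1, gamma1], so that the
    estimator is (S + 1) / (gamma1 - lambda1), and write S' for the same count
    with the i-th p-value left out.  For a true null, U i is independent of the
    other p-values and of (H, xi).  On {U i <= lambda} one has S = S', hence
      E[1{U i <= lambda} / (S + 1)] = E[1{U i <= lambda} / (S' + 1)]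
        = lambda / (gamma1 - lambda1) * E[1{lambda1 < U i <= gamma1} / (S' + 1)],
    and S' + 1 = S on the last event; summing over i bounds the total by
    lambda / (gamma1 - lambda1).  This survives the restriction to an event of
    the tail sigma-algebra, because on {U i <= gamma1} such an event agrees
    with one that does not involve U i.
    For the FDR, a true null with U i <= lambda is rejected iff U i is at most
    the critical value obtained by setting p_i = 0, and the number of rejections
    is then the same.  Conditionally on everything but U i this contributes at
    most alpha / n0' = (alpha / lambda) P(U i <= lambda) / n0', where n0' is the
    estimator with S' for S, which reduces the claim to the bound on
    E[V(lambda) / n0]. *)

(** * Maps measurable for every subset of the codomain *)

(** Asking for all subsets of [K] allows composition with arbitrary functions; the maps in use take
    finitely many values. The sigma-algebra on [T] may be a small one. *)
Definition discretely_measurable d (T : measurableType d) (K : Type)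
    (g : T -> K) : Prop :=
  forall D : set K, measurable (g @^-1` D).

Lemma discretely_measurable_comp d (T : measurableType d) (K L : Type)
    (f : K -> L) (g : T -> K) :
  discretely_measurable g -> discretely_measurable (f \o g).
Proof. by move=> mg D; rewrite comp_preimage; exact: mg. Qed.

Lemma discretely_measurable_fin d (T : measurableType d) (K : finType)
    (g : T -> K) :
  (forall k, measurable (g @^-1` [set k])) -> discretely_measurable g.
Proof.
move=> mg D.
rewrite -(image_id D) -(bigcup_imset1 D id) preimage_bigcup.
by apply: fin_bigcup_measurable => // k _; exact: mg.
Qed.

Lemma discretely_measurable_cst d (T : measurableType d) (K : Type) (k : K) :
  discretely_measurable (fun _ : T => k).
Proof.
by move=> D; rewrite [X in measurable X]preimage_cst; case: ifP.
Qed.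

Lemma discretely_measurable_bool d (T : measurableType d) (g : T -> bool) :
  measurable [set w | g w] -> discretely_measurable g.
Proof.
move=> mg; apply: discretely_measurable_fin => -[].
  by rewrite [X in measurable X](_ : _ = [set w | g w]).
rewrite [X in measurable X](_ : _ = ~` [set w | g w]); first exact: measurableC.
by apply/seteqP; split => w /=; case: (g w).
Qed.

Lemma discretely_measurable_pair d (T : measurableType d) (K L : finType)
    (f : T -> K) (g : T -> L) :
  discretely_measurable f -> discretely_measurable g ->
  discretely_measurable (fun w => (f w, g w)).
Proof.
move=> mf mg; apply: discretely_measurable_fin => -[k l].
rewrite [X in measurable X](_ : _ = f @^-1` [set k] `&` g @^-1` [set l]).
  by apply: measurableI; [exact: mf|exact: mg].
by apply/seteqP; split => w /= [-> ->].
Qed.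

Lemma discretely_measurable_ffun d (T : measurableType d) (I K : finType)
    (g : I -> T -> K) :
  (forall i, discretely_measurable (g i)) ->
  discretely_measurable (fun w => [ffun i => g i w]).
Proof.
move=> mg; apply: discretely_measurable_fin => k.
rewrite [X in measurable X](_ : _ = \bigcap_i (g i @^-1` [set k i])).
  by apply: fin_bigcap_measurable => // i _; exact: mg.
apply/seteqP; split => w /=; first by move=> <- i _ /=; rewrite ffunE.
by move=> gk; apply/ffunP => i; rewrite ffunE; exact: gk.
Qed.

Lemma measurable_discretely_measurable d d' (T : measurableType d)
    (K : measurableType d') (g : T -> K) :
  discretely_measurable g -> measurable_fun [set: T] g.
Proof. by move=> mg _ D _; rewrite setTI; exact: mg. Qed.

Lemma integral_discretely_measurable d (T : measurableType d) (R : realType)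
    (P : probability T R) (K : finType) (g : T -> K) (a : K -> R) :
  discretely_measurable g -> (forall k, 0 <= a k) ->
  (\int[P]_w (a (g w))%:E = \sum_(k : K) (a k)%:E * P (g @^-1` [set k]))%E.
Proof.
move=> mg a0.
transitivity (\int[P]_w
    (\sum_(k : K) (a k)%:E * (\1_(g @^-1` [set k]) w)%:E))%E.
  apply: eq_integral => w _; rewrite (bigD1 (g w))//= big1 ?adde0.
    by rewrite indicE mem_set// mule1.
  by move=> k /eqP kg; rewrite indicE memNset ?mule0//= => gk; apply: kg.
have mI k : measurable_fun [set: T] (fun w => (\1_(g @^-1` [set k]) w)%:E : \bar R).
  by apply/measurable_EFinP/measurable_indic; exact: mg.
rewrite ge0_integral_sum//.
- apply: eq_bigr => k _.
  rewrite ge0_integralZl//; last by rewrite lee_fin.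
  by rewrite integral_indic ?setIT//; exact: mg.
- by move=> k; exact: measurable_funeM.
- by move=> k w _; rewrite mule_ge0// lee_fin.
Qed.

(** * Independence of one variable from all the others *)

(** Dynkin's argument for a fixed [A] in [G1]: the sets [B] with P(A and B) = P(A) P(B) form a
    lambda-system containing the pi-system [G2]. *)
Lemma indep_systems_g_sigma d (T : measurableType d) (R : realType)
    (P : probability T R) (G1 G2 : set (set T)) :
  G1 `<=` measurable -> G2 `<=` measurable -> setI_closed G2 ->
  indep_systems P G1 G2 -> indep_systems P G1 <<s G2 >>.
Proof.
move=> mG1 mG2 G2I indep A B /[dup] G1A /mG1 mA.
suff: <<s G2 >> `<=` [set B | measurable B /\ P (A `&` B) = (P A * P B)%E].
  by move=> /[apply] -[].
apply: lambda_system_subset => //.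
- apply/dynkin_lambda_system; split => /=.
  + by split; [exact: measurableT|rewrite setIT probability_setT mule1].
  + move=> C [mC PC]; split; first exact: measurableC.
    rewrite -setDE measureD//; last by rewrite ltey_eq fin_num_measure.
    transitivity (P A - P A * P C)%E; first by congr (_ - _)%E.
    rewrite probability_setC// muleBr ?mule1//.
      by rewrite fin_num_measure.
  + move=> F tF mF.
    have mFk k : measurable (F k) by case: (mF k).
    split; first exact: bigcup_measurable.
    rewrite setI_bigcupr measure_bigcup//; last 2 first.
      by move=> k _; exact: measurableI.
      exact: trivIset_setIl.
    rewrite measure_bigcup// -(fineK (fin_num_measure P A mA)) -nneseriesZl//.
    by apply: eq_eseriesr => k _; rewrite fineK ?fin_num_measure//; case: (mF k).
- by move=> C G2C; split; [exact: mG2|exact: indep].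
Qed.

(* The condition [B i = setT] removes the i-th variable from the intersection. *)
Definition leave_one_out d (T : measurableType d) (R : realType)
    (P : probability T R) n (U : 'I_n -> {RV P >-> R}) (F : set (set T))
    (i : 'I_n) : set (set T) :=
  [set A | exists (B : 'I_n -> set R) (C : set T),
    [/\ forall j, measurable (B j), B i = setT, F C &
        A = (\bigcap_j (U j @^-1` B j)) `&` C]].

Lemma setI_closed_leave_one_out d (T : measurableType d) (R : realType)
    (P : probability T R) n (U : 'I_n -> {RV P >-> R}) (F : set (set T))
    (i : 'I_n) :
  setI_closed F -> setI_closed (leave_one_out U F i).
Proof.
move=> FI _ _ [B [C [mB Bi FC ->]]] [B' [C' [mB' Bi' FC' ->]]].
exists (fun j => B j `&` B' j), (C `&` C'); split.
- by move=> j; exact: measurableI.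
- by rewrite Bi Bi' setIT.
- exact: FI.
- rewrite setIACA; congr (_ `&` _).
  apply/seteqP; split => [w [Bw B'w] j _|w BB'w]; first by split; [exact: Bw|exact: B'w].
  by split => j jT; case: (BB'w j jT).
Qed.

Lemma leave_one_out_preimage d (T : measurableType d) (R : realType)
    (P : probability T R) n (U : 'I_n -> {RV P >-> R}) (F : set (set T))
    (i j : 'I_n) (B : set R) :
  F setT -> j != i -> measurable B -> leave_one_out U F i (U j @^-1` B).
Proof.
move=> FT ji mB; exists (fun k => if k == j then B else setT), setT; split => //.
- by move=> k; case: ifP.
- by rewrite eq_sym (negbTE ji).
- rewrite setIT; apply/seteqP; split => w /=.
    by move=> Bw k _ /=; case: eqP => [->|].
  by move=> /(_ j Logic.I) /=; rewrite eqxx.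
Qed.

Lemma leave_one_out_sub d (T : measurableType d) (R : realType)
    (P : probability T R) n (U : 'I_n -> {RV P >-> R}) (F : set (set T))
    (i : 'I_n) : F `<=` leave_one_out U F i.
Proof.
move=> C FC; exists (fun=> setT), C; split => //.
by rewrite (_ : \bigcap_j _ = setT) ?setTI//; apply/seteqP; split.
Qed.

Lemma measurable_preimage_RV d d' (T : measurableType d)
    (S : measurableType d') (R : realType)
    (P : probability T R) (X : {RV P >-> S}) (B : set S) :
  measurable B -> measurable (X @^-1` B).
Proof. by move=> mB; rewrite -[X in measurable X]setTI; exact: measurable_funP. Qed.

(** A generator of the second system leaves slot i free, so intersecting it with an event of [U i]
    only fills that slot. The product formula gives independence on a pi-system, which extends to
    the sigma-algebra. *)
Lemma indep_leave_one_out d (T : measurableType d) (R : realType)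
    (P : probability T R) n (U : 'I_n -> {RV P >-> R}) (F : set (set T))
    (i : 'I_n) :
  F `<=` measurable -> setI_closed F -> mutually_independent U ->
  indep_systems P (g_sigma_preimage (fun j w => U j w)) F ->
  indep_systems P (preimage_set_system [set: T] (U i) measurable)
    <<s leave_one_out U F i >>.
Proof.
move=> mF FI indepU indepF.
have mcap (B : 'I_n -> set R) : (forall j, measurable (B j)) ->
    g_sigma_preimage (fun j w => U j w) (\bigcap_j (U j @^-1` B j)).
  move=> mB; rewrite /g_sigma_preimage.
  apply: (@fin_bigcap_measurable _ (g_sigma_algebraType _)) => // j _.
  apply: sub_sigma_algebra; rewrite (bigD1 j)//=; left.
  by exists (B j) => //; rewrite setTI.
apply: indep_systems_g_sigma.
- move=> _ [B mB <-]; rewrite setTI; exact: measurable_preimage_RV.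
- move=> _ [B [C [mB _ FC ->]]]; apply: measurableI; last exact: mF.
  by apply: fin_bigcap_measurable => // j _; exact: measurable_preimage_RV.
- exact: setI_closed_leave_one_out.
move=> _ _ [B mB <-] [B' [C [mB' B'i FC ->]]]; rewrite setTI.
pose B'' j := if j == i then B else B' j.
have mB'' j : measurable (B'' j) by rewrite /B''; case: ifP.
have capE : U i @^-1` B `&` \bigcap_j (U j @^-1` B' j) =
    \bigcap_j (U j @^-1` B'' j).
  apply/seteqP; split => w.
    by move=> [Bw B'w] j _; rewrite /B''; case: eqP => [->//|_]; exact: B'w.
  move=> B''w; split; first by move: (B''w i Logic.I); rewrite /B'' eqxx.
  move=> j _; move: (B''w j Logic.I); rewrite /B''.
  by case: eqP => [->|//] _; rewrite B'i.
have indepT (E : 'I_n -> set R) : (forall j, measurable (E j)) ->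
    P (\bigcap_j (U j @^-1` E j)) = (\prod_(j < n) P (U j @^-1` E j))%E.
  move=> mE; have := indepU [set: 'I_n]%SET E mE.
  rewrite (_ : [set` [set: 'I_n]%SET] = [set: 'I_n]); last first.
    by apply/seteqP; split => // j _ /=; rewrite inE.
  by move=> ->; apply: eq_bigl => j; rewrite inE.
rewrite setIA capE indepF//; last exact: mcap.
rewrite indepF//; last exact: mcap.
rewrite muleA; congr (_ * _)%E.
rewrite !indepT// (bigD1 i)//= [in RHS](bigD1 i)//= B'i preimage_setT.
rewrite probability_setT mul1e /B'' eqxx; congr (_ * _)%E.
by apply: eq_bigr => j /negbTE ->.
Qed.

(** * Comparing integrals under independence *)

Lemma discretely_measurable_threshold d d' (T : measurableType d)
    (S : measurableType d') (V : T -> S) (K : finType) (g : T -> K)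
    (phi : K -> pred S) :
  measurable_fun [set: T] V -> discretely_measurable g ->
  (forall k, measurable [set x | phi k x]) ->
  discretely_measurable (fun w => (g w, phi (g w) (V w))).
Proof.
move=> mV mg mphi.
apply: discretely_measurable_pair => //; apply: discretely_measurable_bool.
rewrite [X in measurable X](_ : _ =
  \bigcup_k (V @^-1` [set x | phi k x] `&` g @^-1` [set k])).
  apply: fin_bigcup_measurable => // k _; apply: measurableI; last exact: mg.
  by rewrite -[X in measurable X]setTI; exact: mV.
apply/seteqP; split => w /=; first by move=> ?; exists (g w).
by move=> [k _ [phik ->]].
Qed.

Lemma measurable_fun_threshold d d' (T : measurableType d)
    (S : measurableType d') (R : realType) (V : T -> S) (K : finType)
    (g : T -> K) (a : K -> R) (phi : K -> pred S) :
  measurable_fun [set: T] V -> discretely_measurable g ->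
  (forall k, measurable [set x | phi k x]) ->
  measurable_fun [set: T]
    (fun w => (a (g w) * (phi (g w) (V w))%:R)%:E : \bar R).
Proof.
move=> mV mg mphi; apply: measurable_discretely_measurable.
exact: (discretely_measurable_comp
  (fun kb : K * bool => (a kb.1 * kb.2%:R)%:E : \bar R)
  (discretely_measurable_threshold mV mg mphi)).
Qed.

(** This replaces conditioning on everything but [V]: [g] is finite-valued and independent of [V],
    so each integral is a sum over [k] of P(g = k) times one side of the last hypothesis. *)
Lemma expectation_indep_le d (T : measurableType d) (R : realType)
    (P : probability T R) (G : set (set T)) (V : {RV P >-> R}) (K : finType)
    (g : T -> K) (a b : K -> R) (phi psi : K -> pred R) :
  <<s G >> `<=` measurable ->
  indep_systems P (preimage_set_system [set: T] V measurable) <<s G >> ->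
  discretely_measurable (g : g_sigma_algebraType G -> K) ->
  (forall k, 0 <= a k) -> (forall k, 0 <= b k) ->
  (forall k, measurable [set x | phi k x]) ->
  (forall k, measurable [set x | psi k x]) ->
  (forall k, (a k)%:E * P (V @^-1` [set x | phi k x]) <=
             (b k)%:E * P (V @^-1` [set x | psi k x]))%E ->
  (\int[P]_w (a (g w) * (phi (g w) (V w))%:R)%:E <=
   \int[P]_w (b (g w) * (psi (g w) (V w))%:R)%:E)%E.
Proof.
move=> mG indep mg a0 b0 mphi mpsi ab.
have mgT : discretely_measurable g by move=> D; apply: mG; exact: mg.
suff intE (c : K -> R) (chi : K -> pred R) : (forall k, 0 <= c k) ->
    (forall k, measurable [set x | chi k x]) ->
    (\int[P]_w (c (g w) * (chi (g w) (V w))%:R)%:E =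
     \sum_(k : K) P (g @^-1` [set k]) *
        ((c k)%:E * P (V @^-1` [set x | chi k x])))%E.
  rewrite !intE//; apply: lee_sum => k _.
  by apply: lee_wpmul2l => //; exact: ab.
move=> c0 mchi.
pose h w := (g w, chi (g w) (V w)).
have hE k : h @^-1` [set (k, true)] =
    V @^-1` [set x | chi k x] `&` g @^-1` [set k].
  apply/seteqP; split => w /=; first by rewrite /h => -[-> ->].
  by move=> [chik gk]; rewrite /h gk chik.
have mh : discretely_measurable h.
  by apply: discretely_measurable_threshold => //; exact: measurable_funP.
rewrite (integral_discretely_measurable (g := h)
  (a := fun kb => c kb.1 * kb.2%:R) _ mh); last first.
  by move=> k; rewrite mulr_ge0.
transitivity (\sum_(k : K) \sum_(e : bool)
    (c k * e%:R)%:E * P (h @^-1` [set (k, e)]))%E.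
  by rewrite pair_bigA/=; apply: eq_bigr => -[].
apply: eq_bigr => k _; rewrite big_bool/= mulr0 mul0e adde0 mulr1.
rewrite hE indep; last 2 first.
- by exists [set x | chi k x]; rewrite ?setTI.
- exact: mg.
by rewrite muleA muleC.
Qed.

(** * Order statistics and the step up rule *)

Lemma bigmax_ord_attained m (Q : pred 'I_m) (k : 'I_m) :
  Q k -> exists2 r : 'I_m, Q r & \max_(s < m | Q s) (s : nat) = r.
Proof.
move=> Qk; have [|r Qr ->] := @eq_bigmax_cond _ Q (fun s => s : nat).
  by apply/card_gt0P; exists k.
by exists r.
Qed.

(** In a sorted list the entries at most [x] form a prefix. This trades order statistics for counts,
    in which a single p-value is easily altered. *)
Lemma order_stat_le n (R : realType) (p : 'I_n -> R) (r : nat) (x : R) :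
  (0 < r <= n)%N ->
  (order_stat p r <= x) = (r <= \sum_(j < n) (p j <= x)%R)%N.
Proof.
case: r => // r /= rn; rewrite /order_stat /=.
set s0 := [seq p j | j <- enum 'I_n]; set s := sort _ s0.
have ss : size s = n by rewrite size_sort size_map size_enum_ord.
have -> : (\sum_(j < n) (p j <= x)%R)%N = count (fun y => y <= x) s.
  rewrite (@permP _ s s0 _ (fun y => y <= x)) ?perm_sort//.
  by rewrite count_map -sum1_count big_enum_cond/= -big_mkcond.
have sorted_s : sorted <=%R s by exact: sort_le_sorted.
have nthle i j : (i <= j < n)%N -> nth 0 s i <= nth 0 s j.
  move=> /andP[ij jn]; apply: (sorted_leq_nth le_trans le_refl) => //.
  - by rewrite inE ss (leq_ltn_trans ij jn).
  - by rewrite inE ss.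
apply/idP/idP => [rx|].
  rewrite -(cat_take_drop r.+1 s) count_cat.
  suff /eqP -> : count (fun y => y <= x) (take r.+1 s) == r.+1 by rewrite leq_addr.
  rewrite -[X in _ == X](@size_takel r.+1 _ s) ?ss// -all_count.
  apply/(all_nthP 0) => i; rewrite size_takel ?ss// => ir.
  by rewrite nth_take// (le_trans _ rx)// nthle// -ltnS ir.
(* Once the entry at index r exceeds [x], so do all later ones, leaving at most r entries to
   count. *)
apply: contraTT; rewrite -ltNge -ltnNge => xr.
rewrite -(cat_take_drop r s) count_cat.
suff -> : count (fun y => y <= x) (drop r s) = 0%N.
  by rewrite addn0 ltnS (leq_trans (count_size _ _))// size_takel// ss ltnW.
apply/eqP; rewrite -leqn0 leqNgt -has_count -all_predC.
apply/(all_nthP 0) => i; rewrite size_drop ss ltn_subRL => irn /=.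
by rewrite nth_drop -ltNge (lt_le_trans xr)// nthle// leq_addr.
Qed.

Lemma su_rejectionsE n (R : realType) (p : 'I_n -> R) (c : nat -> R) :
  su_rejections p c =
  \max_(r < n.+1 | (0 < r)%N && (r <= \sum_(j < n) (p j <= c r)%R)%N) r.
Proof.
apply: eq_bigl => r; case: (posnP r) => //= r0.
by rewrite order_stat_le// r0 -ltnS ltn_ord.
Qed.

(* The number of rejections when the i-th p-value is replaced by 0 while the
   critical values are kept. *)
Definition su_rejections_given n (R : realType) (p : 'I_n -> R)
    (c : nat -> R) (i : 'I_n) : nat :=
  \max_(r < n.+1 |
        (0 < r)%N && (r <= \sum_(j < n) ((j == i) || (p j <= c r)%R))%N) r.

Lemma su_rejections_given_le n (R : realType) (p : 'I_n -> R)
    (c : nat -> R) (i : 'I_n) : (su_rejections_given p c i <= n)%N.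
Proof. by apply/bigmax_leqP => r _; rewrite -ltnS ltn_ord. Qed.

(** r = 1 always qualifies, since index i is counted unconditionally. *)
Lemma su_rejections_given_gt0 n (R : realType) (p : 'I_n -> R)
    (c : nat -> R) (i : 'I_n) : (0 < su_rejections_given p c i)%N.
Proof.
have n1 : (1 < n.+1)%N by rewrite ltnS (leq_trans _ (ltn_ord i)).
apply: leq_trans (leq_bigmax_cond (Ordinal n1) _) => //=.
by rewrite (bigD1 i)//= eqxx.
Qed.

Lemma su_rejections_le_given n (R : realType) (p : 'I_n -> R)
    (c : nat -> R) (i : 'I_n) :
  (su_rejections p c <= su_rejections_given p c i)%N.
Proof.
rewrite su_rejectionsE; apply/bigmax_leqP => r /andP[r0 rp].
apply: leq_bigmax_cond; rewrite r0/=.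
apply: leq_trans rp _; apply: leq_sum => j _.
by case: (j == i); case: (_ <= _).
Qed.

(** The maximal r of the modified count is admissible for the true count too: the only forced term,
    that of i, is present by the hypothesis on [p i]. *)
Lemma su_rejections_rejected n (R : realType) (p : 'I_n -> R)
    (c : nat -> R) (i : 'I_n) :
  {homo c : r s / (r <= s)%N >-> r <= s} ->
  p i <= c (su_rejections_given p c i) ->
  su_rejections p c = su_rejections_given p c i.
Proof.
move=> cM pic; apply/eqP; rewrite eqn_leq su_rejections_le_given/=.
have n1 : (1 < n.+1)%N by rewrite ltnS (leq_trans _ (ltn_ord i)).
have [|r /andP[r0 rp] rE] := @bigmax_ord_attained n.+1
    (fun r => (0 < r)%N && (r <= \sum_(j < n) ((j == i) || (p j <= c r)%R))%N)
    (Ordinal n1).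
  by rewrite /= (bigD1 i)//= eqxx.
rewrite -/(su_rejections_given p c i) in rE.
rewrite rE su_rejectionsE; apply: leq_bigmax_cond; rewrite r0/=.
apply: leq_trans rp _; apply: leq_sum => j _; case: eqP => [->|//].
by rewrite -rE pic.
Qed.

(** Turns rejection into a comparison of [p i] with a bound that, for fixed [c], involves only the
    other p-values. *)
Lemma su_rejected_given n (R : realType) (p : 'I_n -> R)
    (c : nat -> R) (i : 'I_n) :
  {homo c : r s / (r <= s)%N >-> r <= s} ->
  (p i <= c (su_rejections p c)) = (p i <= c (su_rejections_given p c i)).
Proof.
move=> cM; apply/idP/idP => [|pic]; last first.
  by rewrite (su_rejections_rejected cM pic).
by move/le_trans; apply; apply: cM; exact: su_rejections_le_given.
Qed.

(** * Interval counts, the Storey estimator and p-values *)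

(** Between [lambda1] and [gamma1] this is the count S of the overview, and [num_between_except] is
    S'. *)
Definition num_between n (R : realType) (p : 'I_n -> R) (a b : R) : nat :=
  (\sum_(j < n) (a < p j <= b)%R)%N.

Definition num_between_except n (R : realType) (p : 'I_n -> R) (a b : R)
    (i : 'I_n) : nat :=
  (\sum_(j < n | j != i) (a < p j <= b)%R)%N.

Lemma num_betweenE n (R : realType) (p : 'I_n -> R) (a b : R) (i : 'I_n) :
  num_between p a b = ((a < p i <= b)%R + num_between_except p a b i)%N.
Proof. by rewrite /num_between (bigD1 i). Qed.

Lemma num_between_except_le n (R : realType) (p : 'I_n -> R) (a b : R)
    (i : 'I_n) : (num_between_except p a b i <= n)%N.
Proof.
rewrite -[leqRHS]card_ord -sum1_card /num_between_except big_mkcond/=.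
by apply: leq_sum => j _; case: ifP => // _; case: (_ && _).
Qed.

(** As [a <= b], the two indicators differ by that of the interval; multiplying by n turns the added
    1/n into 1. *)
Lemma storeyE n (R : realType) (p : 'I_n -> R) (a b : R) :
  (0 < n)%N -> a <= b ->
  storey a b p = (num_between p a b).+1%:R / (b - a).
Proof.
move=> n0 ab; rewrite /storey mulrA; congr (_ / _).
have nn0 : n%:R != 0 :> R by rewrite pnatr_eq0 -lt0n.
rewrite /ecdf -mulrBr -[X in _ * (_ + X)]mulr1 -mulrDr mulrA mulfV// mul1r.
rewrite -natr1; congr (_ + 1); rewrite -sumrB natr_sum.
apply: eq_bigr => j _; rewrite ltNge.
have [pa|pa] := leP (p j) a; first by rewrite (le_trans pa ab)/= subrr.
by rewrite subr0.
Qed.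
Lemma pvalue_true n (T : Type) (R : realType) (H : 'I_n -> T -> bool)
    (xi U : 'I_n -> T -> R) (w : T) (i : 'I_n) :
  ~~ H i w -> pvalue H xi U w i = U i w.
Proof. by move=> /negbTE Hi; rewrite /pvalue Hi subr0 mul1r mul0r addr0. Qed.

Lemma pvalue_false n (T : Type) (R : realType) (H : 'I_n -> T -> bool)
    (xi U : 'I_n -> T -> R) (w : T) (i : 'I_n) :
  H i w -> pvalue H xi U w i = xi i w.
Proof. by move=> Hi; rewrite /pvalue Hi subrr mul0r mul1r add0r. Qed.

(** Only three booleans matter. The sigma-algebra on [T] is left arbitrary to cover both the full
    one and the one that omits some [U i]. *)
Lemma discretely_measurable_pvalue_le d (T : measurableType d)
    (R : realType) n (H : 'I_n -> T -> bool) (xi U : 'I_n -> T -> R)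
    (i : 'I_n) (t : R) :
  discretely_measurable (H i) ->
  discretely_measurable (fun w => xi i w <= t) ->
  discretely_measurable (fun w => U i w <= t) ->
  discretely_measurable (fun w => pvalue H xi U w i <= t).
Proof.
move=> mH mxi mU.
rewrite (_ : (fun w => _) =
  (fun x : bool * (bool * bool) => if x.1 then x.2.1 else x.2.2) \o
  (fun w => (H i w, (xi i w <= t, U i w <= t)))).
  by apply: discretely_measurable_comp; apply: discretely_measurable_pair => //; exact: discretely_measurable_pair.
apply/funext => w /=; case: ifPn => Hi.
  by rewrite pvalue_false.
by rewrite pvalue_true.
Qed.

(** * The model: sigma-algebras and uniform probabilities *)

Section basic_independence_model.
Context (R : realType) d (T : measurableType d) (P : probability T R) (n : nat)
  (H : 'I_n -> {RV P >-> bool}) (xi U : 'I_n -> {RV P >-> R}).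
Context (hBI : basic_independence H xi U).

Let p := pvalue H xi U.

Let alt_salgebra := g_sigma_preimage (fun i w => (H i w, xi i w)).

(** Generates the information in everything but [U i]; [H i] and [xi i] are kept. *)
Let others i := leave_one_out U alt_salgebra i.

Lemma alt_salgebra_sub : alt_salgebra `<=` measurable.
Proof.
apply: smallest_sub; first exact: sigma_algebra_measurable.
apply: (big_ind (fun F : set (set T) => F `<=` measurable)) => //.
- by move=> F1 F2 mF1 mF2 A [/mF1|/mF2].
- move=> i _ _ [B mB <-].
  have : measurable_fun setT (fun w => (H i w, xi i w)).
    by apply: measurable_fun_pair; exact: measurable_funP.
  by apply.
Qed.

Lemma alt_salgebraI : setI_closed alt_salgebra.
Proof.
by move=> A B mA mB; exact: (@measurableI _ (g_sigma_algebraType _) A B mA mB).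
Qed.

Lemma alt_salgebraT : alt_salgebra setT.
Proof. exact: (@measurableT _ (g_sigma_algebraType _)). Qed.

Lemma alt_salgebra_preimage i (B : set (bool * R)) :
  measurable B -> alt_salgebra ((fun w => (H i w, xi i w)) @^-1` B).
Proof.
move=> mB; apply: sub_sigma_algebra; rewrite (bigD1 i)//=; left.
by exists B => //; rewrite setTI.
Qed.

Lemma others_sub i : <<s others i >> `<=` measurable.
Proof.
apply: smallest_sub; first exact: sigma_algebra_measurable.
move=> _ [B [C [mB _ altC ->]]]; apply: measurableI; last exact: alt_salgebra_sub.
by apply: fin_bigcap_measurable => // j _; exact: measurable_preimage_RV.
Qed.

Lemma others_indep i :
  indep_systems P (preimage_set_system [set: T] (U i) measurable)
    <<s others i >>.
Proof.
case: hBI => _ _ indepU indepUH _; apply: indep_leave_one_out => //.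
- exact: alt_salgebra_sub.
- exact: alt_salgebraI.
Qed.

Lemma measurable_le t : measurable [set x : R | x <= t].
Proof. by rewrite -set_itvNyc. Qed.

Lemma others_hypothesis i j :
  discretely_measurable (H j : g_sigma_algebraType (others i) -> bool).
Proof.
apply: discretely_measurable_bool; apply: sub_sigma_algebra.
apply: leave_one_out_sub.
rewrite (_ : mkset _ = (fun w => (H j w, xi j w)) @^-1` ([set true] `*` setT)).
  by apply: alt_salgebra_preimage; exact: measurableX.
by apply/seteqP; split => w /=; [move=> ->|case].
Qed.

Lemma others_pvalue_le i j t :
  j != i ->
  discretely_measurable
    ((fun w => p w j <= t) : g_sigma_algebraType (others i) -> bool).
Proof.
move=> ji.
apply: (@discretely_measurable_pvalue_le _ (g_sigma_algebraType (others i))).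
- exact: others_hypothesis.
- apply: discretely_measurable_bool; apply: sub_sigma_algebra.
  apply: leave_one_out_sub.
  rewrite (_ : mkset _ =
      (fun w => (H j w, xi j w)) @^-1` (setT `*` [set x | x <= t])).
    by apply: alt_salgebra_preimage; apply: measurableX => //; exact: measurable_le.
  by apply/seteqP; split => w /=; [move=> ->|case].
- apply: discretely_measurable_bool; apply: sub_sigma_algebra.
  apply: (@leave_one_out_preimage _ _ _ _ _ U _ i j [set x | x <= t]) => //.
  + exact: alt_salgebraT.
  + exact: measurable_le.
Qed.

Lemma discretely_measurable_RV d' (S : measurableType d') (X : {RV P >-> S})
    (phi : pred S) :
  measurable [set x | phi x] -> discretely_measurable (fun w => phi (X w)).
Proof.
move=> mphi; apply: discretely_measurable_bool.
rewrite -[mkset _]/(X @^-1` [set x | phi x]).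
exact: measurable_preimage_RV.
Qed.

Lemma pvalue_le_measurable j t : discretely_measurable (fun w => p w j <= t).
Proof.
apply: discretely_measurable_pvalue_le.
- by apply: (@discretely_measurable_RV _ _ (H j) id).
- by apply: (@discretely_measurable_RV _ _ (xi j) (fun x => x <= t)); exact: measurable_le.
- by apply: (@discretely_measurable_RV _ _ (U j) (fun x => x <= t)); exact: measurable_le.
Qed.

(** The uniform law only sees the part of [B] in [0, 1], where its density is 1. *)
Lemma prob_uniform_setI i (B : set R) (I : interval R) :
  measurable B -> B `&` `[0, 1]%classic = [set` I] ->
  P (U i @^-1` B) = lebesgue_measure [set` I].
Proof.
case: hBI => _ unifU _ _ _ mB BI.
rewrite -[LHS]/(distribution P (U i) B) unifU// /uniform_prob.
rewrite integral_uniform_pdf BI.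
rewrite (eq_integral (fun=> 1%:E)) ?integral_cst//= ?mul1e// => x.
rewrite inE -BI => -[_]; rewrite /= in_itv/= /uniform_pdf => ->.
by rewrite subr0 invr1.
Qed.

Lemma prob_uniform_le i t :
  0 <= t <= 1 -> P (U i @^-1` [set x | x <= t]) = t%:E.
Proof.
move=> /andP[t0 t1]; rewrite (@prob_uniform_setI _ _ `[0, t]).
- rewrite lebesgue_measure_itv/= lte_fin; case: ltP => [_|t0'].
    by rewrite -EFinB subr0.
  by congr EFin; apply/eqP; rewrite eq_le t0.
- exact: measurable_le.
- apply/seteqP; split => x /=; rewrite !in_itv/=.
    by move=> [-> /andP[-> _]].
  by move=> /andP[-> xt]; rewrite xt (le_trans xt t1).
Qed.

Lemma prob_uniform_lele i a b :
  0 <= a -> a <= b -> b <= 1 ->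
  P (U i @^-1` [set x | a < x <= b]) = (b - a)%:E.
Proof.
move=> a0 ab b1; rewrite (@prob_uniform_setI _ _ `]a, b]).
- rewrite lebesgue_measure_itv/= lte_fin; case: ltP => [_|ba]; first by rewrite -EFinB.
  by congr EFin; apply/eqP; rewrite eq_sym subr_eq0 eq_le ab ba.
- by rewrite -set_itvoc.
- apply/seteqP; split => x /=; rewrite !in_itv/=.
    by move=> [].
  move=> /andP[ax xb]; rewrite ax xb; split => //.
  by rewrite (le_trans xb b1) (le_trans a0 (ltW ax)).
Qed.

Let others_num_between i (a b : R) :
  discretely_measurable ((fun w => num_between_except (p w) a b i) :
    g_sigma_algebraType (others i) -> nat).
Proof.
(* Coordinate i is constantly false, and [a < p] is written as a negation so that only comparisons
   [p <= t] occur. *)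
pose g (w : g_sigma_algebraType (others i)) :=
  [ffun j => (j != i) && (~~ (p w j <= a) && (p w j <= b))].
have mg : discretely_measurable g.
  apply: discretely_measurable_ffun => j; have [->|ji] := eqVneq j i.
    exact: discretely_measurable_cst.
  exact: (discretely_measurable_comp (fun x => ~~ x.1 && x.2)
    (discretely_measurable_pair (others_pvalue_le a ji) (others_pvalue_le b ji))).
rewrite (_ : (fun w => _) =
    (fun k : {ffun 'I_n -> bool} => \sum_(j | j != i) k j)%N \o g).
  exact: discretely_measurable_comp.
apply/funext => w; apply: eq_bigr => j ji.
by rewrite ffunE ji -ltNge.
Qed.

(** The critical values depend on [w] only through [s w <= n], so finitely many comparisons, one for
    each j and each pair (s, r), decide the value. *)
Let others_su_rejections_given i (c : nat -> nat -> R)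
    (s : g_sigma_algebraType (others i) -> nat) :
  discretely_measurable s -> (forall w, (s w <= n)%N) ->
  discretely_measurable ((fun w => su_rejections_given (p w) (c (s w)) i) :
    g_sigma_algebraType (others i) -> nat).
Proof.
move=> ms sn.
pose g (w : g_sigma_algebraType (others i)) := (inord (s w) : 'I_n.+1,
  [ffun j => [ffun x : 'I_n.+1 * 'I_n.+1 => (j == i) || (p w j <= c x.1 x.2)]]).
have mg : discretely_measurable g.
  apply: discretely_measurable_pair.
    exact: (discretely_measurable_comp (fun k => inord k : 'I_n.+1) ms).
  apply: discretely_measurable_ffun => j; apply: discretely_measurable_ffun => x.
  have [->|ji] := eqVneq j i; first exact: discretely_measurable_cst.
  exact: others_pvalue_le.
rewrite (_ : (fun w => _) =
    (fun k : 'I_n.+1 * {ffun 'I_n -> {ffun 'I_n.+1 * 'I_n.+1 -> bool}} =>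
       \max_(r < n.+1 | (0 < r)%N && (r <= \sum_(j < n) k.2 j (k.1, r))%N) r) \o g).
  exact: discretely_measurable_comp.
apply/funext => w; apply: eq_bigl => r; congr (_ && (_ <= _)%N).
by apply: eq_bigr => j _; rewrite !ffunE/= inordK// ltnS.
Qed.

(** * Bounds on V(lambda) over the estimator *)

Context (lambda lambda1 gamma1 : R).
Context (lambda_gt0 : 0 < lambda) (lambda_le : lambda <= lambda1)
  (lambda1_lt : lambda1 < gamma1) (gamma1_le : gamma1 <= 1).

Let tail := \bigcup_(t in `[gamma1, 1])
  preimage_set_system [set: T] (fun w => ecdf (p w) t) measurable.

Let ratio w := (num_true_below (H ^~ w) (p w) lambda)%:R /
  storey lambda1 gamma1 (p w).

Let others_between i w := num_between_except (p w) lambda1 gamma1 i.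

Lemma tail_sub : <<s tail >> `<=` measurable.
Proof.
apply: smallest_sub; first exact: sigma_algebra_measurable.
move=> _ [t _ [D mD <-]]; rewrite setTI.
rewrite (_ : (fun w => _) =
    (fun k : {ffun 'I_n -> bool} => n%:R^-1 * \sum_(j < n) (k j)%:R) \o
    (fun w => [ffun j => p w j <= t])).
  apply: discretely_measurable_comp; apply: discretely_measurable_ffun => j.
  exact: pvalue_le_measurable.
by apply/funext => w /=; congr (_ * _); apply: eq_bigr => j _; rewrite ffunE.
Qed.

(* On [U i w <= gamma1] the i-th p-value is counted by every [ecdf (p w) t]
   with [gamma1 <= t], so that its exact value is irrelevant there. *)
Lemma tail_trace i (A : set T) :
  <<s tail >> A ->
  exists B, <<s others i >> B /\
    forall w, ~~ H i w -> U i w <= gamma1 -> A w <-> B w.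
Proof.
(* [Q] is closed under complements and countable unions, so only the generators need a witness. *)
pose Q := [set A | exists B, <<s others i >> B /\
    forall w, ~~ H i w -> U i w <= gamma1 -> A w <-> B w].
suff: <<s tail >> `<=` Q by apply.
apply: smallest_sub; first split.
- by exists set0; split => //; exact: (@measurable0 _ (g_sigma_algebraType _)).
- move=> E [B [mB EB]]; exists (~` B); split.
    exact: (@measurableC _ (g_sigma_algebraType _)).
  by move=> w Hw Uw; rewrite setTD /=; have := EB w Hw Uw; rewrite /setC /=; tauto.
- move=> F /choice[B mB]; exists (\bigcup_k B k); split.
    apply: (@bigcupT_measurable _ (g_sigma_algebraType (others i))) => k.
    by case: (mB k).
  by move=> w Hw Uw; split => -[k _ Fk]; exists k => //;
    have [_ /(_ w Hw Uw)] := mB k; tauto.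
- move=> _ [t /= + [D mD <-]]; rewrite in_itv/= => /andP[gt _].
  pose g (w : g_sigma_algebraType (others i)) :=
    [ffun j => (j == i) || (p w j <= t)].
  pose f (k : {ffun 'I_n -> bool}) : R := n%:R^-1 * \sum_(j < n) (k j)%:R.
  exists ((f \o g) @^-1` D); split.
    have mg : discretely_measurable g.
      apply: discretely_measurable_ffun => j; have [->|ji] := eqVneq j i.
        exact: discretely_measurable_cst.
      exact: others_pvalue_le.
    exact: (discretely_measurable_comp f mg D).
  move=> w Hw Uw; rewrite setTI /preimage/=.
  rewrite (_ : f (g w) = ecdf (p w) t)//; congr (_ * _).
  apply: eq_bigr => j _; rewrite ffunE; case: eqP => [->|//]/=.
  by rewrite /p pvalue_true// (le_trans Uw gt).
Qed.

(** A true null with [U i w <= lambda] has its p-value outside the interval, as [lambda <= lambda1];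
    there S = S', and the denominator is free of [U i]. *)
Lemma ratioE w :
  ratio w = \sum_(i < n) (~~ H i w)%:R * (gamma1 - lambda1) /
    (others_between i w).+1%:R * (U i w <= lambda)%R%:R.
Proof.
rewrite /ratio /num_true_below natr_sum mulr_suml; apply: eq_bigr => i _.
have [Hi|Hi] := boolP (H i w); first by rewrite andbF !mul0r.
rewrite /p pvalue_true// andbT; case: leP => Ui; rewrite ?mulr0 ?mul0r//.
rewrite storeyE ?(leq_ltn_trans _ (ltn_ord i))//; last exact: ltW.
rewrite mul1r mulr1 mul1r invf_div /others_between (num_betweenE _ _ _ i).
by rewrite /p pvalue_true// ltNge (le_trans Ui lambda_le).
Qed.

(** Stated over any event of the tail sigma-algebra, so as to yield both the conditional bound and,
    on the whole space, the plain one. *)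
Lemma ratio_integral_le (A : set T) :
  <<s tail >> A ->
  (\int[P]_(w in A) (ratio w)%:E <= lambda%:E * P A)%E.
Proof.
move=> tailA; have mA := tail_sub tailA.
have /choice[B othersB] := fun i => tail_trace i tailA.
(* [g i] gathers what the i-th summand needs besides [U i], with [B i] standing in for [A]; [inord]
   is faithful because the count is at most n. *)
pose g i w := (~~ H i w && `[< B i w >], inord (others_between i w) : 'I_n.+1).
pose a (c : R) (k : bool * 'I_n.+1) : R := k.1%:R * c / k.2.+1%:R.
have a_ge0 c k : 0 <= c -> 0 <= a c k by move=> c0; rewrite !mulr_ge0.
have mg i : discretely_measurable (g i : g_sigma_algebraType (others i) -> _).
  apply: (@discretely_measurable_pair _ (g_sigma_algebraType (others i))).
    have mB : discretely_measurable
        ((fun w => `[< B i w >]) : g_sigma_algebraType (others i) -> bool).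
      apply: discretely_measurable_bool.
      rewrite (_ : mkset _ = B i); first by case: (othersB i).
      by apply/seteqP; split => w /=; [move/asboolP|move=> ?; apply/asboolP].
    exact: (discretely_measurable_comp (fun x => ~~ x.1 && x.2)
      (discretely_measurable_pair (@others_hypothesis i i) mB)).
  exact: (discretely_measurable_comp (fun k => inord k : 'I_n.+1)
    (@others_num_between i lambda1 gamma1)).
have mgT i : discretely_measurable (g i) by move=> D; apply: others_sub; exact: mg.
have mbetween : measurable [set x : R | lambda1 < x <= gamma1] by rewrite -set_itvoc.
have gap_gt0 : 0 < gamma1 - lambda1 by rewrite subr_gt0.
pose X i w : \bar R := (a (gamma1 - lambda1) (g i w) * (U i w <= lambda)%R%:R)%:E.
pose Y i w : \bar R := (a lambda (g i w) * (lambda1 < U i w <= gamma1)%R%:R)%:E.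
have mX i : measurable_fun [set: T] (X i).
  apply: (@measurable_fun_threshold _ _ _ _ _ (U i) _ (g i)
    (a (gamma1 - lambda1)) (fun=> fun x => x <= lambda)) => //.
  by move=> _; exact: measurable_le.
have mY i : measurable_fun [set: T] (Y i).
  exact: (@measurable_fun_threshold _ _ _ _ _ (U i) _ (g i)
    (a lambda) (fun=> fun x => lambda1 < x <= gamma1)).
have X0 i w : (0 <= X i w)%E by rewrite lee_fin mulr_ge0// a_ge0// ltW.
have Y0 i w : (0 <= Y i w)%E by rewrite lee_fin mulr_ge0// a_ge0// ltW.
apply: (@le_trans _ _ (\int[P]_w \sum_(i < n) X i w)%E).
  rewrite integral_mkcond le_eqVlt; apply/orP; left; apply/eqP.
  apply: eq_integral => w _; rewrite patchE sumEFin; case: ifPn.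
    rewrite inE => Aw; rewrite ratioE; congr EFin; apply: eq_bigr => i _.
    rewrite /a /g /= inordK ?ltnS ?num_between_except_le//.
    have [Hi|Hi] := boolP (H i w); first by rewrite !mul0r.
    case: leP => Ui; rewrite ?mulr0//.
    have [_ /(_ w Hi)[]] := othersB i; first by rewrite (le_trans Ui)// (le_trans lambda_le)// ltW.
    by move=> /(_ Aw) Bw _; rewrite asboolT.
  rewrite notin_setE => nAw; rewrite big1// => i _; rewrite /a /g /=.
  have [Hi|Hi] := boolP (H i w); first by rewrite !mul0r.
  case: leP => Ui; rewrite ?mulr0//.
  have [_ /(_ w Hi)[]] := othersB i; first by rewrite (le_trans Ui)// (le_trans lambda_le)// ltW.
  by move=> _ BA; rewrite asboolF ?mul0r// => /BA.
(* For fixed other data both sides agree: the factor and the probability of the event, [lambda] and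
   [gamma1 - lambda1], merely trade places. *)
apply: (@le_trans _ _ (\int[P]_w \sum_(i < n) Y i w)%E).
  rewrite !ge0_integral_sum//; apply: lee_sum => i _.
  apply: (@expectation_indep_le _ _ _ _ _ (U i) _ (g i)
    (a (gamma1 - lambda1)) (a lambda) (fun=> fun x => x <= lambda)
    (fun=> fun x => lambda1 < x <= gamma1) _ (@others_indep i)) => //.
  - exact: others_sub.
  - by move=> k; rewrite a_ge0// ltW.
  - by move=> k; rewrite a_ge0// ltW.
  - by move=> _; exact: measurable_le.
  move=> k; rewrite prob_uniform_le; last first.
    by rewrite ltW//= (le_trans lambda_le)// (le_trans (ltW lambda1_lt)).
  rewrite prob_uniform_lele//; last 2 first.
  - by rewrite (le_trans (ltW lambda_gt0)).
  - exact: ltW.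
  by rewrite -!EFinM lee_fin /a le_eqVlt; apply/orP; left; apply/eqP; field.
rewrite -[leRHS](_ : \int[P]_w (lambda%:E * (\1_A w)%:E) = _)%E; last first.
  rewrite ge0_integralZl//; last by rewrite lee_fin ltW.
    by rewrite integral_indic// setIT.
  exact/measurable_EFinP/measurable_indic.
apply: ge0_le_integral => //.
- by move=> w _; exact: sume_ge0.
- exact: emeasurable_sum.
- by apply: measurable_funeM; exact/measurable_EFinP/measurable_indic.
move=> w _; rewrite sumEFin -EFinM lee_fin indicE.
(* Off [A], a true null with [U i w <= gamma1] is also off [B i], so every term vanishes. *)
have [Aw|nAw] := boolP (w \in A); last first.
  rewrite mulr0 big1// => i _; rewrite /a /g /=.
  have [Hi|Hi] := boolP (H i w); first by rewrite !mul0r.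
  case: (boolP (lambda1 < U i w <= gamma1)) => [/andP[_ Ui]|_]; rewrite ?mulr0//.
  have [_ /(_ w Hi Ui)[_ BA]] := othersB i.
  by rewrite asboolF ?mul0r// => /BA Aw; case/negP: nAw; rewrite inE.
rewrite mulr1.
(* If S = 0 all terms vanish. Otherwise each p-value in the interval gives at most [lambda] / S,
   because S' + 1 = S there, and S such terms add up to [lambda]. *)
have [S0|S_gt0] := posnP (num_between (p w) lambda1 gamma1).
  rewrite big1 ?ltW// => i _; rewrite /a /g /=.
  have [Hi|Hi] := boolP (H i w); first by rewrite !mul0r.
  move: S0; rewrite (num_betweenE _ _ _ i) => /eqP.
  rewrite addn_eq0 eqb0 /p pvalue_true// => /andP[/negbTE -> _].
  by rewrite mulr0.
apply: (@le_trans _ _ (\sum_(i < n) (lambda1 < p w i <= gamma1)%R%:R *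
    (lambda / (num_between (p w) lambda1 gamma1)%:R))).
  apply: ler_sum => i _; rewrite /a /g /=.
  have [Hi|Hi] := boolP (H i w).
    by rewrite !mul0r mulr_ge0// divr_ge0// ltW.
  rewrite /= (num_betweenE _ _ _ i) /p pvalue_true//.
  case: (lambda1 < U i w <= gamma1); rewrite ?mulr0 ?mul0r// mulr1 mul1r -mulrA.
  rewrite inordK ?ltnS ?num_between_except_le// add1n.
  by apply: ler_piMl; [rewrite divr_ge0// ltW|case: asbool].
rewrite -mulr_suml -natr_sum -/(num_between (p w) lambda1 gamma1).
by rewrite mulrCA mulfV ?mulr1// pnatr_eq0 -lt0n.
Qed.

(** The event [Y > lambda] lies in the tail sigma-algebra. Over it [Y - lambda] has integral at most
    0 by the bound on the ratio, yet is positive, so the event is null. *)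
Lemma cond_exp_ratio_le (Y : T -> R) :
  is_cond_exp P tail ratio Y -> {ae P, forall w, Y w <= lambda}.
Proof.
move=> [mY iY intY].
pose A := Y @^-1` `]lambda, +oo[%classic.
have tailA : <<s tail >> A by rewrite -[A]setTI; exact: mY.
have mA := tail_sub tailA.
have iYA : P.-integrable A (EFin \o Y) by exact: integrableS iY.
have icst : P.-integrable A (EFin \o cst lambda).
  exact/finite_measure_integrable_cst.
have YA w : A w -> (0 <= (Y w)%:E - lambda%:E)%E.
  by rewrite /A /= in_itv/= andbT => Yw; rewrite -EFinB lee_fin subr_ge0 ltW.
have intA0 : (\int[P]_(w in A) `|(Y w)%:E - lambda%:E| = 0)%E.
  rewrite (eq_integral (fun w => (Y w)%:E - lambda%:E)%E); last first.
    by move=> w; rewrite inE => Aw; rewrite gee0_abs// YA.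
  apply/eqP; rewrite eq_le integral_ge0// andbT.
  have intcst : (\int[P]_(w in A) (cst lambda w)%:E = lambda%:E * P A)%E.
    exact: (integral_cst P mA lambda%:E).
  rewrite (integralB_EFin mA iYA icst) intcst intY// leeBlDr ?add0e//.
    exact: ratio_integral_le.
  by rewrite fin_numM// fin_num_measure.
have mYl : measurable_fun A (fun w => (Y w)%:E - lambda%:E)%E.
  by apply: emeasurable_funB; [exact: measurable_int iYA|exact: measurable_cst].
have [/(_ intA0) + _] := ae_eq_integral_abs P mA mYl.
apply: filterS => w /= Aw; rewrite leNgt; apply/negP => lYw.
have /Aw : A w by rewrite /A /= in_itv/= andbT.
by rewrite -EFinB => -[/eqP]; rewrite subr_eq0 (gt_eqF lYw).
Qed.

(** * False discovery rate *)

Context (alpha : R) (alpha_gt0 : 0 < alpha).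

(** Critical values for an interval count of s; at S' they do not involve [U i]. *)
Let crit s := adaptive_crit (s.+1%:R / (gamma1 - lambda1)) alpha lambda.

Let rejections i w :=
  su_rejections_given (p w) (crit (others_between i w)) i.

Let crit_homo s : {homo crit s : q r / (q <= r)%N >-> q <= r}.
Proof.
move=> q r qr; rewrite /crit /adaptive_crit le_min !ge_min lexx orbT andbT.
apply/orP; left; rewrite -!mulrA ler_wpM2r ?ler_nat//.
by rewrite mulr_ge0 ?invr_ge0 ?divr_ge0 ?subr_ge0// ltW.
Qed.

(** For a true null with [U i w <= lambda], S = S' puts the critical values in a form free of [U i],
    so [p i] may be set to 0 in the step up rule. *)
Lemma fdp_storeyE w :
  let c := adaptive_crit (storey lambda1 gamma1 (p w)) alpha lambda in
  (su_false_rejections (H ^~ w) (p w) c)%:R /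
    (maxn (su_rejections (p w) c) 1)%:R =
  \sum_(i < n) (~~ H i w)%:R / (rejections i w)%:R *
    (U i w <= crit (others_between i w) (rejections i w))%R%:R :> R.
Proof.
move=> c; rewrite /su_false_rejections /num_true_below natr_sum mulr_suml.
apply: eq_bigr => i _.
have [Hi|Hi] := boolP (H i w); first by rewrite andbF !mul0r.
have pU : p w i = U i w by rewrite /p pvalue_true.
have crit_le s r : crit s r <= lambda by rewrite ge_min lexx orbT.
rewrite andbT pU mul1r; have [Ul|Ul] := leP (U i w) lambda; last first.
  (* Critical values are capped at [lambda], so neither indicator holds. *)
  by rewrite !leNgt !(le_lt_trans _ Ul) ?mul0r ?mulr0// ge_min lexx orbT.
have cE : c = crit (others_between i w).
  rewrite /c storeyE ?(leq_ltn_trans _ (ltn_ord i))//; last exact: ltW.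
  rewrite (num_betweenE _ _ _ i).
  by rewrite pU ltNge (le_trans Ul lambda_le).
rewrite cE -pU su_rejected_given; last exact: crit_homo.
rewrite -/(rejections i w); case: leP => pc; last by rewrite mul0r mulr0.
rewrite mul1r mulr1 (su_rejections_rejected (crit_homo _) pc).
by rewrite (maxn_idPl _)// su_rejections_given_gt0.
Qed.

Lemma FDR_storey_le :
  (FDR P H p (fun w => adaptive_crit (storey lambda1 gamma1 (p w)) alpha lambda)
    <= alpha%:E)%E.
Proof.
rewrite /FDR unlock; under eq_integral do rewrite fdp_storeyE.
pose K := (bool * 'I_n.+1 * 'I_n.+1)%type.
pose g i w : K :=
  (~~ H i w, inord (others_between i w), inord (rejections i w)).
(* For true nulls, [a] is one over the number of rejections and goes with the rejection event; [b]
   is one over the estimator with S' and goes with [U i w <= lambda]. *)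
pose a (k : K) : R := k.1.1%:R / k.2%:R.
pose b (k : K) : R := k.1.1%:R * (gamma1 - lambda1) / k.1.2.+1%:R.
have gap_gt0 : 0 < gamma1 - lambda1 by rewrite subr_gt0.
have a_ge0 k : 0 <= a k by rewrite divr_ge0.
have b_ge0 k : 0 <= b k by rewrite !mulr_ge0// ltW.
have mg i : discretely_measurable (g i : g_sigma_algebraType (others i) -> K).
  have mS : discretely_measurable
      (others_between i : g_sigma_algebraType (others i) -> nat).
    exact: others_num_between.
  have mR := @others_su_rejections_given i crit _ mS
    (fun w => num_between_except_le _ _ _ _).
  apply: (@discretely_measurable_pair _ (g_sigma_algebraType (others i))).
    apply: (@discretely_measurable_pair _ (g_sigma_algebraType (others i))).
      exact: (discretely_measurable_comp negb (@others_hypothesis i i)).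
    exact: (discretely_measurable_comp (fun k => inord k : 'I_n.+1) mS).
  exact: (discretely_measurable_comp (fun k => inord k : 'I_n.+1) mR).
have mgT i : discretely_measurable (g i) by move=> D; apply: others_sub; exact: mg.
have crit01 s r : 0 <= crit s r <= 1.
  rewrite /crit /adaptive_crit le_min (ltW lambda_gt0) andbT ge_min.
  apply/andP; split; first by rewrite !mulr_ge0 ?invr_ge0 ?divr_ge0 ?subr_ge0// ltW.
  by rewrite (le_trans lambda_le) ?orbT// (le_trans (ltW lambda1_lt)).
have lambda01 : 0 <= lambda <= 1.
  by rewrite ltW//= (le_trans lambda_le)// (le_trans (ltW lambda1_lt)).
pose c (k : K) : pred R := fun x => x <= crit k.1.2 k.2.
pose V i w : \bar R := (a (g i w) * (c (g i w) (U i w))%:R)%:E.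
pose W i w : \bar R := (b (g i w) * (U i w <= lambda)%R%:R)%:E.
have mV i : measurable_fun [set: T] (V i).
  apply: (@measurable_fun_threshold _ _ _ _ _ (U i) _ (g i) a c) => //.
  by move=> k; exact: measurable_le.
have mW i : measurable_fun [set: T] (W i).
  apply: (@measurable_fun_threshold _ _ _ _ _ (U i) _ (g i) b
    (fun=> fun x => x <= lambda)) => //.
  by move=> k; exact: measurable_le.
have V0 i w : (0 <= V i w)%E by rewrite lee_fin mulr_ge0.
have W0 i w : (0 <= W i w)%E by rewrite lee_fin mulr_ge0.
have al0 : 0 <= alpha / lambda by rewrite divr_ge0// ltW.
apply: (@le_trans _ _ (\int[P]_w \sum_(i < n) V i w)%E).
  rewrite le_eqVlt; apply/orP; left; apply/eqP.
  apply: eq_integral => w _; rewrite sumEFin; congr EFin.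
  apply: eq_bigr => i _; rewrite /a /c /g /=.
  by rewrite !inordK ?ltnS ?num_between_except_le ?su_rejections_given_le.
(* With r rejections the critical value is at most r [alpha] over the estimator with S'; r cancels
   against the 1/r in [a]. *)
apply: (@le_trans _ _ (\sum_(i < n) (alpha / lambda)%:E * \int[P]_w W i w)%E).
  rewrite ge0_integral_sum//; apply: lee_sum => i _.
  rewrite -ge0_integralZl//.
  rewrite [leRHS](eq_integral (fun w => (alpha / lambda * b (g i w) *
      (U i w <= lambda)%R%:R)%:E)); last first.
    by move=> w _; rewrite /W -EFinM mulrA.
  apply: (@expectation_indep_le _ _ _ _ _ (U i) _ (g i) a
    (fun k => alpha / lambda * b k) c (fun=> fun x => x <= lambda) _
    (@others_indep i)) => //.
  - exact: others_sub.
  - by move=> k; rewrite mulr_ge0.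
  - by move=> k; exact: measurable_le.
  - by move=> k; exact: measurable_le.
  move=> k; rewrite !prob_uniform_le// -!EFinM lee_fin.
  (* r = 0 never comes from [g], but [k] ranges over all of [K]; there [a k] is 0, the inverse of 0
     being 0. *)
  have [k0|k_gt0] := posnP k.2.
    rewrite /a k0 invr0 mulr0 mul0r.
    by apply: mulr_ge0; [exact: mulr_ge0|exact: ltW].
  apply: (@le_trans _ _ (a k *
      (k.2%:R / (k.1.2.+1%:R / (gamma1 - lambda1)) * alpha))).
    by rewrite ler_wpM2l// ge_min lexx.
  rewrite le_eqVlt; apply/orP; left; apply/eqP; rewrite /a /b; field.
  by rewrite addrC natr1 !pnatr_eq0 (gtn_eqF k_gt0) (gt_eqF lambda_gt0)
    (gt_eqF gap_gt0).
(* The [W i] add up to the ratio, whose integral over the whole space is at most [lambda]. *)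
rewrite -ge0_sume_distrr; last by move=> i _; exact: integral_ge0.
rewrite -ge0_integral_sum//.
rewrite (eq_integral (EFin \o ratio)); last first.
  move=> w _; rewrite sumEFin /= ratioE; congr EFin.
  by apply: eq_bigr => i _; rewrite /b /g /= inordK// ltnS num_between_except_le.
apply: (@le_trans _ _ ((alpha / lambda)%:E * lambda%:E)%E); last first.
  by rewrite -EFinM divfK// gt_eqF.
apply: lee_wpmul2l; first by rewrite lee_fin.
have := ratio_integral_le (A := setT).
rewrite probability_setT mule1; apply.
exact: (@measurableT _ (g_sigma_algebraType _)).
Qed.

End basic_independence_model.

Theorem theorem2 (R : realType) (d : measure_display) (T : measurableType d)
    (P : probability T R) (n : nat) (H : 'I_n -> {RV P >-> bool})
    (xi U : 'I_n -> {RV P >-> R}) (lambda lambda1 gamma1 alpha : R)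
    (hn : (1 <= n)%N) (hBI : basic_independence H xi U)
    (hlambda : 0 < lambda) (hlambda1 : lambda <= lambda1)
    (hgamma : lambda1 < gamma1) (hgamma1 : gamma1 <= 1)
    (halpha : 0 < alpha) (halphalambda : alpha < lambda) :
  let p := pvalue H xi U in
  let n0 := fun w => storey lambda1 gamma1 (p w) in
  let ratio := fun w => (num_true_below (H ^~ w) (p w) lambda)%:R / n0 w in
  [/\ forall Y : T -> R,
        is_cond_exp P
          (\bigcup_(t in `[gamma1, 1])
             preimage_set_system [set: T] (fun w => ecdf (p w) t) measurable)
          ratio Y ->
        {ae P, forall w, Y w <= lambda},
      ('E_P[ratio] <= lambda%:E)%E
    & (FDR P H p (fun w => adaptive_crit (n0 w) alpha lambda) <= alpha%:E)%E].
Proof.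
move=> p n0 ratio; split.
- by move=> Y; exact: cond_exp_ratio_le.
- rewrite unlock; have := ratio_integral_le hBI hlambda hlambda1 hgamma hgamma1
    (@measurableT _ (g_sigma_algebraType _)).
  by rewrite probability_setT mule1.
- exact: FDR_storey_le.
Qed.
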